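(* Let $a>0$, $\beta>0$, let $n\ge 1$ be an integer and let $0<\alpha<1$. Let $$L_{n}=\beta\left(\frac{1}{\gamma_{na;\,\alpha/2}/(na)}-\frac{1}{\gamma_{na;\,1-\alpha/2}/(na)}\right)$$ be the average length of the standard level $1-\alpha$ confidence interval for the scale parameter $\beta$, based on a sample of size $n$ from $Gamma(a,\beta)$ with known shape parameter $a$; let $L_{n+1}$ be the same quantity with $n$ replaced by $n+1$ (with the same $a,\beta,\alpha$). If $\alpha<\alpha^{*}(n,a)$, then $L_{n+1}<L_{n}$.
   Context: For $a>0,\beta>0$, $Gamma(a,\beta)$ is the distribution with density $f(x;a,\beta)=\frac{1}{\beta^{a}\Gamma(a)}x^{a-1}e^{-x/\beta}$, $x>0$. For $0<p<1$, $\gamma_{s;\,p}$ denotes the quantile of order $p$ of $Gamma(s,1)$, i.e. the unique $x>0$ at which the distribution function of $Gamma(s,1)$ equals $p$. If $X_1,\ldots,X_n$ are i.i.d. $Gamma(a,\beta)$ with $a$ known and $\overline{X}_n=\frac1n\sum_{i=1}^n X_i$, then $n\overline{X}_n/\beta\sim Gamma(na,1)$, and the standard confidence interval of level $1-\alpha$ for $\beta$ is $\left(\frac{n\overline{X}_{n}}{\gamma_{na;\,1-\alpha/2}},\ \frac{n\overline{X}_{n}}{\gamma_{na;\,\alpha/2}}\right)$. Its average (expected) length is $L_n$. Definition of $\alpha^*(n,a)$: let $F_1$ be the distribution function of $Gamma\left(na,\frac{1}{na}\right)$ and $F_2$ that of $Gamma\left((n+1)a,\frac{1}{(n+1)a}\right)$.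 There is a unique $x^*>0$ such that $F_1(x)>F_2(x)$ for $0<x<x^*$ and $F_1(x)<F_2(x)$ for $x>x^*$; then $\alpha^{*}(n,a)=F_1(x^* )=F_2(x^* )$. *)

(* Defs.v *)
From mathcomp Require Import all_boot all_order all_algebra.
From mathcomp Require Import all_classical all_reals all_analysis.

Set Implicit Arguments.
Unset Strict Implicit.
Unset Printing Implicit Defensive.

Import Order.TTheory GRing.Theory Num.Theory.
Import numFieldNormedType.Exports.

Local Open Scope classical_set_scope.
Local Open Scope ring_scope.

Definition Gamma_fun {R : realType} (a : R) : R :=
  (\int[lebesgue_measure]_(x in `]0, +oo[) (x `^ (a - 1) * expR (- x)))%R.

(* [b] is the scale (not the rate) parameter. *)
Definition gamma_pdf {R : realType} (a b x : R) : R :=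
  if 0 < x then (b `^ a * Gamma_fun a)^-1 * x `^ (a - 1) * expR (- (x / b))
  else 0.

Definition gamma_prob {R : realType} (a b : R) (A : set R) : \bar R :=
  (\int[lebesgue_measure]_(x in A) (gamma_pdf a b x)%:E)%E.

Definition gamma_cdf {R : realType} (a b x : R) : R :=
  fine (gamma_prob a b `]-oo, x]).

(* For [0 < s] and [0 < p < 1] the set is a singleton; the default [0] is a
   junk value outside this range. *)
Definition gamma_quantile {R : realType} (s p : R) : R :=
  xget 0 [set x | 0 < x /\ gamma_cdf s 1 x = p].

(* The law of the mean of [n] independent Gamma(a, b) variables divided by its
   expectation [a * b] is Gamma(n a, 1 / (n a)). *)
Definition mean_cdf {R : realType} (n : nat) (a x : R) : R :=
  gamma_cdf (n%:R * a) (n%:R * a)^-1 x.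

Definition is_crossing {R : realType} (n : nat) (a x0 : R) : Prop :=
  [/\ 0 < x0,
      forall x, 0 < x -> x < x0 -> mean_cdf n.+1 a x < mean_cdf n a x
    & forall x, x0 < x -> mean_cdf n a x < mean_cdf n.+1 a x].

(* For [0 < n] and [0 < a] there is exactly one crossing point, at which the two
   distribution functions agree by continuity. *)
Definition alpha_star {R : realType} (n : nat) (a : R) : R :=
  mean_cdf n a (xget 0 [set x0 | is_crossing n a x0]).

(* The interval for the scale [b] from a sample with sum [S] is
   (S / gamma_quantile (n a) (1 - alpha / 2),
    S / gamma_quantile (n a) (alpha / 2));
   its mean length is obtained from E[S] = n a b. *)
Definition mean_ci_length {R : realType} (n : nat) (a b alpha : R) : R :=
  b * (1 / (gamma_quantile (n%:R * a) (alpha / 2) / (n%:R * a))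
       - 1 / (gamma_quantile (n%:R * a) (1 - alpha / 2) / (n%:R * a))).

(* Main.v *)
Require Import Defs.
From mathcomp Require Import all_boot all_order all_algebra.
From mathcomp Require Import all_classical all_reals all_analysis.
From mathcomp Require Import measurable_realfun ring lra.
Import Order.TTheory GRing.Theory Num.Theory.
Import numFieldNormedType.Exports.
Local Open Scope classical_set_scope.
Local Open Scope ring_scope.

(** Put [s = n a] and [t = (n + 1) a], let [q_s p] be the quantile of order [p]
    of Gamma(s, 1) divided by [s], and put [p1 = alpha / 2] and
    [p2 = 1 - alpha / 2].
    Up to the factor [b], the mean length for [n] observations is
    [1 / q_s p1 - 1 / q_s p2 = (1 / q_s p1) (1 - q_s p1 / q_s p2)], and both
    factors decrease when [s] is replaced by [t] ([inv_diff_lt]).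

    For the first factor: as [p1 < alpha < alpha_star], the point [q_s p1] lies
    before the crossing point of the two normalized distribution functions,
    where that of index [n + 1] is the smaller one and so reaches the level [p1]
    later, that is, [q_s p1 < q_t p1] ([normalized_quantile_lt]).

    For the second factor: the ratio of two quantiles does not depend on the
    normalization, and Gamma(s, 1) dominates Gamma(t, 1) in the star order
    ([gamma_quantile_ratio_lt]).  Indeed, let [F_s] be the distribution function
    of Gamma(s, 1).  For any dilation factor [c], the logarithm of the ratio of
    the densities of [x |-> F_t (c x)] and [F_s] is strictly concave, so the difference [F_s x - F_t (c x)], which vanishes at 0
    and at infinity, is negative after any positive zero
    ([negative_after_zero], [dilated_cdf_lt]).

    What remains is the calculus of the gamma distribution functions: they are
    continuous, differentiable on the positive axis with the density as
    derivative, and tend to 1 at infinity.  This rests on the integrability of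
    [x `^ (s - 1) * expR (- (x / b))], obtained by domination by a multiple of
    the log-logistic density, whose primitive is explicit
    ([gamma_kernel_integrable]). *)

(** * Cumulative integrals of densities on the positive axis *)

Definition cumulative_integral {R : realType} (f : R -> R) (x : R) : R :=
  (\int[lebesgue_measure]_(t in `]-oo, x]) f t)%R.

Section cumulative_integral_theory.
Context {R : realType} (f : R -> R).
Notation mu := (@lebesgue_measure R).
Context (f_ge0 : forall x : R, 0 <= f x)
  (f_eq0 : forall x : R, x <= 0 -> f x = 0)
  (f_int : mu.-integrable [set: R] (EFin \o f)).

Local Notation F := (cumulative_integral f).

Let f_intS (A : set R) : measurable A -> mu.-integrable A (EFin \o f).
Proof. by move=> mA; apply: integrableS f_int. Qed.

Lemma cumulative_le0 (x : R) : x <= 0 -> cumulative_integral f x = 0.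
Proof.
move=> x0; rewrite /cumulative_integral /Rintegral integral0_eq//= => y.
by rewrite in_itv/= => yx; rewrite f_eq0// (le_trans yx).
Qed.

Lemma cumulative_nondecreasing : nondecreasing_fun (cumulative_integral f).
Proof.
move=> x y xy; rewrite /cumulative_integral /Rintegral.
have fin z : ((\int[mu]_(t in `]-oo, z]) (f t)%:E)%E \is a fin_num).
  by apply: integrable_fin_num => //; exact: f_intS.
rewrite fine_le//; apply: ge0_subset_integral => //=.
- by have /integrableP[] := f_intS _ (measurable_itv `]-oo, y]).
- by move=> t _; rewrite lee_fin.
- by apply: subset_itvl; rewrite bnd_simp.
Qed.

Lemma cumulative_le_total x : cumulative_integral f x <= (\int[mu]_t f t)%R.
Proof.
rewrite /cumulative_integral /Rintegral fine_le//.
- by apply: integrable_fin_num => //; exact: f_intS.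
- by apply: integrable_fin_num.
apply: ge0_subset_integral => //=.
- by have /integrableP[] := f_int.
- by move=> t _; rewrite lee_fin.
Qed.

(** A monotone bounded function converges at infinity, and monotone
    convergence along the half-lines with integer endpoints identifies the
    limit. *)
Lemma cumulative_cvgy :
  cumulative_integral f x @[x --> +oo] --> (\int[mu]_t f t)%R.
Proof.
have Fs := @nondecreasing_cvgr R F cumulative_nondecreasing.
have /Fs {}Fs : has_ubound (range F).
  by exists (\int[mu]_t f t)%R => _ [x _ <-]; exact: cumulative_le_total.
suff Fn : F n%:R @[n --> \oo] --> (\int[mu]_t f t)%R.
  have Fns : F n%:R @[n --> \oo] --> sup (range F).
    by move/cvg_pinftyP : Fs; apply; exact/cvgryPge/nbhs_infty_ger.
  by rewrite -(cvg_unique _ Fns Fn).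
apply: fine_cvg; rewrite fineK; last exact: integrable_fin_num.
have U : \bigcup_n [set` `]-oo, (n%:R : R)]%R] = [set: R].
  rewrite -subTset => t _/=.
  by exists (Num.truncn t).+1; rewrite //= in_itv/= ltW// Num.Theory.truncnS_gt.
rewrite -[in X in _ --> X]U.
apply: ge0_nondecreasing_set_cvg_integral => //=.
- move=> n m nm; apply/subsetPset => x/=; rewrite !in_itv/= => /le_trans.
  by apply; rewrite ler_nat.
- by move=> i; have /integrableP[] := f_intS _ (measurable_itv `]-oo, i%:R]).
- by move=> i x _; rewrite lee_fin.
Qed.

(** Continuity is needed at 0 as well, where the densities below may blow up;
    it only uses the absolute continuity of the integral.  Since [f] vanishes
    on the negative axis, the half-line may be cut at any [- M <= 0]. *)
Lemma cumulative_continuous : continuous (cumulative_integral f).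
Proof.
move=> x; set M := `|x| + 1.
have M0 : 0 < M by rewrite ltr_wpDl.
have xM : x \in `]- M, M[ by rewrite in_itv/= -ltr_norml /M ltrDl.
have FE : F = (fun y => \int[mu]_(t in `[- M, y]) f t)%R.
  apply/funext => y; rewrite /cumulative_integral.
  rewrite Rintegral_mkcond [RHS]Rintegral_mkcond.
  congr Rintegral; apply/funext => t; rewrite !patchE.
  have [tM|tM] := leP (- M) t.
    by congr (if _ then _ else _); apply/idP/idP; rewrite !inE/= !in_itv/= ?tM.
  have -> : f t = 0 by rewrite f_eq0// (le_trans (ltW tM))// oppr_le0 ltW.
  by rewrite !if_same.
have MM : - M <= M by lra.
have fM := f_intS _ (measurable_itv `[- M, M]).
have := @parameterized_integral_continuous R (- M) M f MM fM.
rewrite FE => /continuous_within_itvP[|+ _ _]; first by lra.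
by apply.
Qed.

Lemma is_derive_cumulative x : {for x, continuous f} ->
  is_derive x 1 (cumulative_integral f) (f x).
Proof.
move=> cf; have xx1 : x < x + 1 by rewrite ltrDl.
have fx1 := f_intS _ (measurable_itv `]-oo, x + 1]).
rewrite /cumulative_integral.
have [|dF F'] := continuous_FTC1 xx1 fx1 _ cf; first by rewrite /= ltNyr.
apply: DeriveDef; first exact: dF.
by rewrite -derive1E; exact: F'.
Qed.

End cumulative_integral_theory.

(** * Sign changes of functions and strict concavity *)

Lemma continuous_MVT {R : realType} (H h : R -> R) (x y : R) :
  continuous H -> (forall z : R, x < z -> is_derive z 1 H (h z)) -> x < y ->
  exists2 z, x < z < y & H y - H x = h z * (y - x).
Proof.
move=> cH dH xy.
have dH' z : z \in `]x, y[ -> is_derive z 1 H (h z).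
  by rewrite in_itv/= => /andP[xz _]; exact: dH.
have [|z] := MVT xy dH'; first by apply: continuous_subspaceT => z; exact: cH.
by rewrite in_itv/= => zxy; exists z.
Qed.

(** The engine of the proof.  Suppose [H x0 = 0], [x0 < x1] and [0 <= H x1].
    Then [h] vanishes somewhere before [x0] and is nonnegative somewhere
    between [x0] and [x1].  The hypothesis on the signs of [h] forbids
    [h <= 0] any later, so [H] increases strictly after [x1] and cannot tend
    to 0. *)
Lemma negative_after_zero {R : realType} (H h : R -> R) (x0 x1 : R) :
  continuous H -> (forall x : R, 0 < x -> is_derive x 1 H (h x)) ->
  H 0 = 0 -> H x @[x --> +oo] --> 0 ->
  (forall y0 y1 y2 : R, 0 < y0 -> y0 < y1 -> y1 < y2 ->
     h y0 <= 0 -> h y2 <= 0 -> h y1 < 0) ->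
  0 < x0 -> H x0 = 0 -> x0 < x1 -> H x1 < 0.
Proof.
move=> cH dH H0 Hy hconv x00 Hx0 x01; rewrite ltNge; apply/negP => Hx1.
have [y0 /andP[y00 y0x0]] := continuous_MVT H h 0 x0 cH dH x00.
rewrite Hx0 H0 subrr subr0 => /esym/eqP.
rewrite mulf_eq0 (gt_eqF x00) orbF => /eqP hy0.
have dHS (x : R) (x_gt0 : 0 < x) (z : R) : x < z -> is_derive z 1 H (h z).
  by move=> xz; apply: dH; exact: lt_trans xz.
have [y1 /andP[x0y1 y1x1] E1] := continuous_MVT H h x0 x1 cH (dHS _ x00) x01.
have hy1 : 0 <= h y1.
  by rewrite -(@pmulr_lge0 _ (x1 - x0)) ?subr_gt0// -E1 Hx0 subr0.
have hpos y : y1 < y -> 0 < h y.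
  move=> y1y; rewrite ltNge; apply/negP => hy.
  have := hconv y0 y1 y y00 (lt_trans y0x0 x0y1) y1y.
  by rewrite hy0 lexx => /(_ isT hy); rewrite ltNge hy1.
have Hincr x y : x1 <= x -> x < y -> H x < H y.
  move=> x1x xy; have y1x := lt_le_trans y1x1 x1x.
  have x_gt0 : 0 < x by lra.
  have [z /andP[xz zy] E] := continuous_MVT H h x y cH (dHS _ x_gt0) xy.
  by rewrite -subr_gt0 E mulr_gt0 ?subr_gt0// hpos// (lt_trans y1x).
have : H (x1 + 1) <= 0.
  rewrite leNgt; apply/negP => Hpos.
  have [M [_ HM]] : \forall x \near +oo, `|0 - H x| < H (x1 + 1).
    by move/cvgrPdist_lt : Hy; apply.
  have := HM (Num.max (M + 1) (x1 + 2)).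
  rewrite lt_max ltrDl ltr01 => /(_ isT).
  have : H (x1 + 1) < H (Num.max (M + 1) (x1 + 2)).
    by apply: Hincr; [lra|rewrite lt_max; apply/orP; right; lra].
  move=> HH; rewrite sub0r normrN gtr0_norm ?(lt_trans Hpos)//.
  by move/(lt_trans HH); rewrite ltxx.
have : H x1 < H (x1 + 1) by apply: Hincr; lra.
by move=> /(le_lt_trans Hx1)/lt_le_trans/[apply]; rewrite ltxx.
Qed.

Lemma ln_lt_tangent {R : realType} (y z : R) : 0 < y -> 0 < z -> y != z ->
  ln y < ln z + (y - z) / z.
Proof.
move=> y0 z0 yz; rewrite -ltrBlDl -ln_div ?posrE//.
have yz0 : 0 < y / z by rewrite divr_gt0.
rewrite -ltr_expR lnK ?posrE//.
have -> : y / z = 1 + (y - z) / z by field; rewrite gt_eqF.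
by apply: expR_gt1Dx; rewrite mulf_neq0 ?invr_eq0 ?subr_eq0// gt_eqF.
Qed.

(** Strict concavity of [y |-> d * ln y + e * y], in the only form needed: the
    function lies strictly below its tangent at [y1], and that tangent is at
    most its value at [y1] at one of the two points [y0], [y2], depending on
    the sign of its slope. *)
Lemma log_affine_superlevel {R : realType} (k d e y0 y1 y2 : R) :
  0 < d -> 0 < y0 -> y0 < y1 -> y1 < y2 ->
  k <= d * ln y0 + e * y0 -> k <= d * ln y2 + e * y2 ->
  k < d * ln y1 + e * y1.
Proof.
move=> d0 y00 y01 y12 k0 k2.
have y1_gt0 := lt_trans y00 y01; have y2_gt0 := lt_trans y1_gt0 y12.
have tangent y : 0 < y -> y != y1 ->
    d * ln y + e * y < d * ln y1 + e * y1 + (d / y1 + e) * (y - y1).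
  move=> yp yy1; have := ln_lt_tangent y y1 yp y1_gt0 yy1.
  rewrite -(ltr_pM2l d0) => H.
  rewrite -(ltrD2r (- (e * y))) addrK (lt_le_trans H)// le_eqVlt.
  apply/orP; left.
  by apply/eqP; field; rewrite gt_eqF.
have [s0|s0] := leP 0 (d / y1 + e).
  apply: (le_lt_trans k0); apply: (lt_le_trans (tangent _ y00 _)).
    by rewrite lt_eqF.
  by rewrite gerDl mulr_ge0_le0// subr_le0 ltW.
apply: (le_lt_trans k2); apply: (lt_le_trans (tangent _ y2_gt0 _)).
  by rewrite gt_eqF.
by rewrite gerDl mulr_le0_ge0// ?subr_ge0 ltW.
Qed.

(** * Integrability of the gamma kernel *)

Lemma continuous_at_powR {R : realType} (p x : R) : 0 < x ->
  {for x, continuous (fun y => y `^ p)}.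
Proof.
move=> x0; apply: differentiable_continuous; apply/derivable1_diffP.
by apply: derivable_powR; rewrite in_itv/= x0.
Qed.

(** The derivative of [x `^ s / (1 + x `^ s)], which rises from 0 to 1 over the
    positive axis: it has the same singularity at 0 as the gamma densities and
    an elementary primitive. *)
Definition log_logistic_pdf {R : realType} (s x : R) : R :=
  s * x `^ (s - 1) / (1 + x `^ s) ^+ 2.

Lemma log_logistic_pdf_ge0 {R : realType} (s x : R) :
  0 <= s -> 0 <= log_logistic_pdf s x.
Proof.
move=> s0; have D1 : 0 <= 1 + x `^ s by rewrite addr_ge0 ?powR_ge0.
by rewrite /log_logistic_pdf !mulr_ge0 ?powR_ge0 ?invr_ge0 ?exprn_ge0.
Qed.

Lemma log_logistic_pdf_continuous {R : realType} (s x : R) : 0 < x ->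
  {for x, continuous (log_logistic_pdf s)}.
Proof.
move=> x0; apply: cvgM.
  by apply: cvgM; [exact: cvg_cst|exact: continuous_at_powR].
apply: cvgV; first by rewrite expf_neq0 ?lt0r_neq0 ?ltr_pwDl ?powR_ge0.
under eq_fun do rewrite expr2; rewrite expr2.
by apply: cvgM; (apply: cvgD; [exact: cvg_cst|exact: continuous_at_powR]).
Qed.

(** The primitive is used on compact intervals exhausting the positive axis, as
    the integrand is unbounded near 0 when [s < 1]. *)
Lemma integral_log_logistic_le1 {R : realType} (s : R) : 0 < s ->
  (\int[lebesgue_measure]_(x in `]0%R, +oo[) (log_logistic_pdf s x)%:E <= 1)%E.
Proof.
move=> s0; set g := log_logistic_pdf s.
have cg (x : R) : 0 < x -> {for x, continuous g}.
  exact: log_logistic_pdf_continuous.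
(* x `^ s / (1 + x `^ s) up to an additive constant *)
pose P (x : R) := - (1 + x `^ s)^-1.
have D1 (x : R) : 0 < 1 + x `^ s by rewrite ltr_pwDl ?powR_ge0.
have dP (x : R) : 0 < x -> is_derive x 1 P (g x).
  move=> x0; rewrite /P.
  have d1 : is_derive x 1 (fun y : R => 1 + y `^ s) (0 + s * x `^ (s - 1)).
    apply: is_deriveD.
    exact: is_derive1_powR.
  have d2 := @is_deriveV R _ x _ 1 (lt0r_neq0 (D1 x)) d1.
  apply: is_derive_eq; rewrite /g /log_logistic_pdf /GRing.scale/= add0r.
  by field; rewrite gt_eqF.
pose I n := [set` `[(n.+1%:R : R)^-1, n.+2%:R]%R] : set R.
have -> : `]0%R, +oo[%classic = \bigcup_n I n :> set R.
  apply/seteqP; split=> x /=; rewrite in_itv/= ?andbT.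
    move=> x0; exists (Num.truncn (x + x^-1)) => //=.
    have xx := Num.Theory.truncnS_gt (x + x^-1).
    have xV0 : 0 < x^-1 by rewrite invr_gt0.
    rewrite /I/= in_itv/=; apply/andP; split.
      rewrite -[leRHS]invrK lef_pV2 ?posrE//.
      by rewrite (le_trans _ (ltW xx))// lerDr ltW.
    rewrite (le_trans _ (le_trans (ltW xx) _))//; last by rewrite ler_nat.
    by rewrite lerDl ltW.
  case=> n _; rewrite /I/= in_itv/= => /andP[+ _].
  by apply: lt_le_trans; rewrite invr_gt0.
have I0 n x : I n x -> 0 < x.
  rewrite /I/= in_itv/= => /andP[+ _].
  by apply: lt_le_trans; rewrite invr_gt0.
have g0 x : 0 < x -> (0 <= (g x)%:E)%E.
  by move=> x0; rewrite lee_fin log_logistic_pdf_ge0// ltW.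
have cI n : {within I n, continuous g}.
  by apply: continuous_in_subspaceT => x; rewrite inE => /I0; exact: cg.
have H : (\int[lebesgue_measure]_(x in I i) (g x)%:E @[i --> \oo] -->
    \int[lebesgue_measure]_(x in \bigcup_i I i) (g x)%:E)%E.
  apply: ge0_nondecreasing_set_cvg_integral => //.
  - move=> n m nm; apply/subsetPset => x; rewrite /I/= !in_itv/= => /andP[a b].
    rewrite (le_trans _ a) ?(le_trans b) ?ler_nat//.
    by rewrite lef_pV2 ?posrE// ler_nat.
  - by move=> n; exact: measurable_itv.
  - move=> n; apply/measurable_EFinP.
    by apply: subspace_continuous_measurable_fun => //; exact: measurable_itv.
  - by move=> n x /I0; exact: g0.
apply: (cvge_to_le H); apply: nearW => n.
have n12 : (n.+1%:R : R)^-1 < n.+2%:R.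
  by rewrite (@le_lt_trans _ _ 1)// ?ltr1n// invf_le1 ?ler1n.
have c0 : 0 < (n.+1%:R : R)^-1 by rewrite invr_gt0.
rewrite (@continuous_FTC2 _ g P _ _ n12).
- rewrite -EFinB lee_fin /P opprK addrC lerBlDr (@le_trans _ _ 1)//.
    by rewrite invf_le1// lerDl powR_ge0.
  by rewrite lerDl invr_ge0 ltW.
- exact: cI.
- split.
  + move=> x; rewrite in_itv/= => /andP[cx _].
    by have /dP[] := lt_trans c0 cx.
  + apply: cvg_at_right_filter.
    apply: differentiable_continuous; apply/derivable1_diffP.
    by have [] := dP _ c0.
  + apply: cvg_at_left_filter.
    apply: differentiable_continuous; apply/derivable1_diffP.
    by have [] := dP _ (lt_trans c0 n12).
- move=> x; rewrite in_itv/= => /andP[cx _].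
  by have [_ <-] := dP _ (lt_trans c0 cx); rewrite derive1E.
Qed.

Lemma powR_le_expR {R : realType} (s r x : R) : 0 < s -> 0 < r -> 0 < x ->
  x `^ s <= expR (s * ln (s / r)) * expR (r * x).
Proof.
move=> s0 r0 x0; rewrite /powR gt_eqF// -expRD ler_expR.
have q0 : 0 < r / s by rewrite divr_gt0.
have -> : r * x = s * (r / s * x) by field; rewrite gt_eqF.
rewrite -mulrDr ler_pM2l//.
have := ln_sublinear (mulr_gt0 q0 x0).
rewrite (@lnM _ (r / s)) ?posrE//.
have -> : r / s = (s / r)^-1 by rewrite invf_div.
by rewrite lnV ?posrE ?divr_gt0//; lra.
Qed.

Definition gamma_kernel {R : realType} (s b x : R) : R :=
  if 0 < x then x `^ (s - 1) * expR (- (x / b)) else 0.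

Lemma gamma_kernel_ge0 {R : realType} (s b x : R) : 0 <= gamma_kernel s b x.
Proof.
by rewrite /gamma_kernel; case: ifP => // _; rewrite mulr_ge0 ?powR_ge0 ?expR_ge0.
Qed.

Lemma gamma_kernel_gt0 {R : realType} (s b x : R) :
  0 < x -> 0 < gamma_kernel s b x.
Proof. by move=> x0; rewrite /gamma_kernel x0 mulr_gt0 ?powR_gt0 ?expR_gt0. Qed.

Lemma gamma_kernel_le0 {R : realType} (s b x : R) :
  x <= 0 -> gamma_kernel s b x = 0.
Proof. by move=> x0; rewrite /gamma_kernel ltNge x0. Qed.

Lemma gamma_kernel_continuous {R : realType} (s b x : R) : 0 < x ->
  {for x, continuous (gamma_kernel s b)}.
Proof.
move=> x0.
have E : \near x, x `^ (s - 1) * expR (- (x / b)) = gamma_kernel s b x.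
  near=> y; rewrite /gamma_kernel ifT//; near: y; exact: lt_nbhsr.
rewrite /prop_for /continuous_at -(nbhs_singleton E).
apply: cvg_trans (near_eq_cvg E) _.
apply: cvgM; first exact: continuous_at_powR.
apply: continuous_comp; last exact: continuous_expR.
by apply: cvgN; apply: cvgMl.
Unshelve. all: by end_near. Qed.

Lemma gamma_kernel_measurable {R : realType} (s b : R) :
  measurable_fun [set: R] (gamma_kernel s b).
Proof.
apply: measurable_fun_ifT => //.
  exact: measurable_fun_ltr.
apply: measurable_funM; first exact: measurable_powR.
apply: measurableT_comp; first exact: measurable_expR.
by apply: measurableT_comp => //; exact: measurable_funM.
Qed.

(** Domination by a multiple of the log-logistic density: the quotient of the
    two is a constant times [expR (- (x / b)) * (1 + x `^ s) ^+ 2], and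
    [x `^ s <= D * expR (x / (2 * b))]. *)
Lemma gamma_kernel_integrable {R : realType} (s b : R) : 0 < s -> 0 < b ->
  (@lebesgue_measure R).-integrable [set: R] (EFin \o gamma_kernel s b).
Proof.
move=> s0 b0.
pose g : R -> R := log_logistic_pdf s.
(* half of the decay rate, because [1 + x `^ s] gets squared *)
pose r := (2 * b)^-1.
have r0 : 0 < r by rewrite invr_gt0 mulr_gt0.
pose D := expR (s * ln (s / r)).
pose C := (1 + D) ^+ 2 / s.
have D1 (x : R) : 0 < 1 + x `^ s by rewrite ltr_pwDl ?powR_ge0.
have kg (x : R) : 0 < x -> gamma_kernel s b x <= C * g x.
  move=> x0; rewrite /gamma_kernel x0.
  have -> : C * g x = x `^ (s - 1) * (((1 + D) / (1 + x `^ s)) ^+ 2).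
    by rewrite /C /g /log_logistic_pdf; field; rewrite !gt_eqF.
  rewrite ler_wpM2l ?powR_ge0//.
  have -> : expR (- (x / b)) = (expR (- (r * x))) ^+ 2.
    by rewrite expr2 -expRD /r; congr expR; field; rewrite gt_eqF.
  rewrite lerXn2r// ?nnegrE ?expR_ge0//.
    by rewrite divr_ge0 ?ltW// addr_gt0// expR_gt0.
  rewrite ler_pdivlMr// expRN mulrC ler_pdivrMr ?expR_gt0// mulrDl mul1r.
  rewrite lerD// ?powR_le_expR//.
  by rewrite -expR0 ler_expR mulr_ge0// ltW.
have mk := gamma_kernel_measurable s b.
have mg : measurable_fun (`]0, +oo[%classic : set R) g.
  apply: open_continuous_measurable_fun; first exact: interval_open.
  by move=> x; rewrite inE/= in_itv/= andbT; exact: log_logistic_pdf_continuous.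
apply/integrableP; split; first exact/measurable_EFinP.
(* the kernel vanishes outside the open half-line *)
have -> : (\int[lebesgue_measure]_x `|(EFin \o gamma_kernel s b) x| =
   \int[lebesgue_measure]_(x in `]0%R, +oo[) (gamma_kernel s b x)%:E)%E.
  rewrite [RHS]integral_mkcond; apply: eq_integral => x _.
  rewrite patchE mem_setE in_itv/= andbT ger0_norm ?gamma_kernel_ge0//.
  by case: ifPn => // /negbTE x0; rewrite /gamma_kernel x0.
have C0 : 0 <= C by rewrite divr_ge0 ?exprn_ge0 ?addr_ge0 ?expR_ge0// ltW.
apply: (@le_lt_trans _ _
  (\int[lebesgue_measure]_(x in `]0%R, +oo[) (C%:E * (g x)%:E))%E).
  apply: ge0_le_integral => //=.
  - by move=> x _; rewrite lee_fin gamma_kernel_ge0.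
  - by apply/measurable_EFinP; exact: measurable_funTS.
  - by apply: measurable_funeM; exact/measurable_EFinP.
  - by move=> x; rewrite in_itv/= andbT => x0; rewrite -EFinM lee_fin kg.
rewrite ge0_integralZl_EFin//; first last.
- exact/measurable_EFinP.
- move=> x; rewrite /= in_itv/= andbT => x0.
  by rewrite lee_fin log_logistic_pdf_ge0// ltW.
apply: (@le_lt_trans _ _ (C%:E * 1)%E); last by rewrite mule1 ltry.
by apply: lee_wpmul2l; [rewrite lee_fin|exact: integral_log_logistic_le1].
Qed.

(** * Gamma distribution functions and quantiles *)

Lemma Gamma_funE {R : realType} (s : R) :
  Gamma_fun s = (\int[lebesgue_measure]_x gamma_kernel s 1 x)%R.
Proof.
rewrite /Gamma_fun Rintegral_mkcond; apply: eq_Rintegral => x _.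
by rewrite patchE mem_setE in_itv/= andbT /gamma_kernel divr1.
Qed.

(** The mean value theorem on [0, 1] shows that the integral of the kernel up to
    1 is already positive. *)
Lemma Gamma_fun_gt0 {R : realType} (s : R) : 0 < s -> 0 < Gamma_fun s.
Proof.
move=> s0; rewrite Gamma_funE.
pose k := @gamma_kernel R s 1.
have k0 (x : R) : 0 <= k x := gamma_kernel_ge0 s 1 x.
have kN (x : R) : x <= 0 -> k x = 0 := @gamma_kernel_le0 R s 1 x.
have ki := gamma_kernel_integrable s 1 s0 ltr01.
apply: (lt_le_trans _ (cumulative_le_total k k0 ki 1)).
have dk (x : R) : 0 < x -> is_derive x 1 (cumulative_integral k) (k x).
  by move=> x0; apply: is_derive_cumulative ki _ _; exact: gamma_kernel_continuous.
have [z /andP[z0 _]] :=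
  continuous_MVT _ _ 0 1 (cumulative_continuous k kN ki) dk ltr01.
rewrite (cumulative_le0 k kN 0 (lexx 0)) !subr0 mulr1 => ->.
exact: gamma_kernel_gt0.
Qed.

Section gamma_cdf_theory.
Context {R : realType} (s b : R) (s_gt0 : 0 < s) (b_gt0 : 0 < b).

Let c := (b `^ s * Gamma_fun s)^-1.

Let c_gt0 : 0 < c.
Proof. by rewrite invr_gt0 mulr_gt0 ?powR_gt0 ?Gamma_fun_gt0. Qed.

Lemma gamma_pdfE x :
  gamma_pdf s b x = (b `^ s * Gamma_fun s)^-1 * gamma_kernel s b x.
Proof.
by rewrite /gamma_pdf /gamma_kernel; case: ifP; rewrite ?mulr0 ?mulrA.
Qed.

Lemma gamma_pdf_gt0 (x : R) : 0 < x -> 0 < gamma_pdf s b x.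
Proof. by move=> x0; rewrite gamma_pdfE mulr_gt0// gamma_kernel_gt0. Qed.

Let pdf_ge0 (x : R) : 0 <= gamma_pdf s b x.
Proof. by rewrite gamma_pdfE mulr_ge0 ?gamma_kernel_ge0 ?ltW. Qed.

Let pdf_eq0 (x : R) : x <= 0 -> gamma_pdf s b x = 0.
Proof. by move=> x0; rewrite gamma_pdfE gamma_kernel_le0 ?mulr0. Qed.

Let pdf_int :
  (@lebesgue_measure R).-integrable [set: R] (EFin \o gamma_pdf s b).
Proof.
have -> : EFin \o gamma_pdf s b =
    (fun x => c%:E * (EFin \o gamma_kernel s b) x)%E.
  by apply/funext => x; rewrite /= gamma_pdfE.
by apply: integrableZl => //; exact: gamma_kernel_integrable.
Qed.

Lemma gamma_cdf_le0 (x : R) : x <= 0 -> gamma_cdf s b x = 0.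
Proof. exact: (cumulative_le0 _ pdf_eq0). Qed.

Lemma gamma_cdf_nondecreasing : nondecreasing_fun (gamma_cdf s b).
Proof. exact: (cumulative_nondecreasing _ pdf_ge0 pdf_int). Qed.

Lemma gamma_cdf_continuous : continuous (gamma_cdf s b).
Proof. exact: (cumulative_continuous _ pdf_eq0 pdf_int). Qed.

Lemma is_derive_gamma_cdf (x : R) : 0 < x ->
  is_derive x 1 (gamma_cdf s b) (gamma_pdf s b x).
Proof.
move=> x0; apply: (is_derive_cumulative _ pdf_int).
have -> : gamma_pdf s b = (fun y => c * gamma_kernel s b y).
  by apply/funext => y; exact: gamma_pdfE.
by apply: cvgM; [exact: cvg_cst|exact: gamma_kernel_continuous].
Qed.

Lemma gamma_cdf_cvgy_total :
  gamma_cdf s b x @[x --> +oo] -->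
    c * (\int[lebesgue_measure]_x gamma_kernel s b x)%R.
Proof.
have -> : c * (\int[lebesgue_measure]_x gamma_kernel s b x)%R =
    (\int[lebesgue_measure]_x gamma_pdf s b x)%R.
  rewrite -RintegralZl//; last exact: gamma_kernel_integrable.
  by apply: eq_Rintegral => x _; rewrite gamma_pdfE.
exact: (cumulative_cvgy _ pdf_ge0 pdf_int).
Qed.

End gamma_cdf_theory.

Lemma gamma_cdf_cvgy {R : realType} (s : R) : 0 < s ->
  gamma_cdf s 1 x @[x --> +oo] --> (1 : R).
Proof.
move=> s0; have := gamma_cdf_cvgy_total s 1 s0 ltr01.
by rewrite -Gamma_funE powR1 mul1r mulVf// gt_eqF// Gamma_fun_gt0.
Qed.

Lemma is_derive_dilation {R : realType} (f : R -> R) (c x df : R) :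
  is_derive (c * x) 1 f df -> is_derive x 1 (fun y => f (c * y)) (c * df).
Proof.
move=> d; have dc : is_derive x 1 (fun y : R => c * y) c.
  by have := is_deriveZ c (is_derive_id x (1 : R)); rewrite /GRing.scale/= mulr1.
have := @is_derive1_comp _ f (fun y => c * y) x df c d dc.
by rewrite mulrC.
Qed.

Lemma gamma_pdf_scale {R : realType} (s b x : R) : 0 < b -> 0 < x ->
  gamma_pdf s b x = b^-1 * gamma_pdf s 1 (b^-1 * x).
Proof.
move=> b0 x0; rewrite /gamma_pdf x0 mulr_gt0 ?invr_gt0// powR1 mul1r divr1.
rewrite powRM ?invr_ge0 ?ltW// (mulrC b^-1 x).
have -> : b^-1 `^ (s - 1) = b * (b `^ s)^-1.
  rewrite -powR_inv1 ?ltW// -powRrM mulN1r opprB powRD ?(lt0r_neq0 b0) ?implybT//.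
  by rewrite powRr1 ?ltW// powRN.
rewrite invfM; move: (Gamma_fun s)^-1 => G.
by field; rewrite !gt_eqF ?powR_gt0.
Qed.

(** Both sides vanish at 0 and have the same derivative on the positive axis. *)
Lemma gamma_cdf_scale {R : realType} (s b x : R) : 0 < s -> 0 < b -> 0 < x ->
  gamma_cdf s b x = gamma_cdf s 1 (b^-1 * x).
Proof.
move=> s0 b0 x0; apply/eqP; rewrite -subr_eq0.
have bV0 : 0 < b^-1 by rewrite invr_gt0.
pose H y := gamma_cdf s b y - gamma_cdf s 1 (b^-1 * y).
have cH : continuous H.
  move=> y; apply: cvgB; first exact: gamma_cdf_continuous.
  apply: continuous_comp; first exact: cvgMr.
  exact: gamma_cdf_continuous.
have dH (y : R) : 0 < y -> is_derive y 1 H (cst 0 y).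
  move=> y0; rewrite /= -(subrr (gamma_pdf s b y)) {2}gamma_pdf_scale//.
  apply: is_deriveB; first exact: is_derive_gamma_cdf.
  by apply: is_derive_dilation; apply: is_derive_gamma_cdf => //; exact: mulr_gt0.
have [z _] := continuous_MVT H _ 0 x cH dH x0.
have H0 : H 0 = 0 by rewrite /H mulr0 !gamma_cdf_le0// subrr.
by rewrite H0 subr0 /= mul0r => /eqP.
Qed.

Lemma gamma_quantileP {R : realType} (s p : R) : 0 < s -> 0 < p -> p < 1 ->
  0 < gamma_quantile s p /\ gamma_cdf s 1 (gamma_quantile s p) = p.
Proof.
move=> s0 p0 p1; apply: (@xgetPex _ 0 [set x | 0 < x /\ gamma_cdf s 1 x = p]).
have [M [_ HM]] : \forall x \near +oo, p < gamma_cdf s 1 x.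
  by apply: cvgr_gt p1; exact: gamma_cdf_cvgy.
pose N := Num.max 0 M + 1.
have N0 : 0 < N by rewrite ltr_wpDl// le_max lexx.
have pN : p < gamma_cdf s 1 N.
  apply: HM; rewrite /N (@le_lt_trans _ _ (Num.max 0 M)) ?ltrDl//.
  by rewrite le_max lexx orbT.
have cw : {within `[0, N], continuous (gamma_cdf s 1)}.
  by apply: continuous_subspaceT => y; exact: gamma_cdf_continuous.
have [|q _ qp] := @IVT R _ 0 N p (ltW N0) cw.
  rewrite gamma_cdf_le0// ge_min (ltW p0)/= le_max (ltW pN) orbT//.
exists q; split => //; rewrite ltNge; apply/negP => q0.
by move: p0; rewrite -qp gamma_cdf_le0// ltxx.
Qed.

Lemma gamma_quantile_lt {R : realType} (s p1 p2 : R) :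
  0 < s -> 0 < p1 -> p1 < p2 -> p2 < 1 ->
  gamma_quantile s p1 < gamma_quantile s p2.
Proof.
move=> s0 p10 p12 p21.
have [_ Fs1] := gamma_quantileP s p1 s0 p10 (lt_trans p12 p21).
have [_ Fs2] := gamma_quantileP s p2 s0 (lt_trans p10 p12) p21.
rewrite ltNge; apply/negP => /(gamma_cdf_nondecreasing _ _ s0 ltr01).
by rewrite Fs1 Fs2 leNgt p12.
Qed.

(** * The star order of gamma laws *)

Lemma ln_gamma_pdf {R : realType} (s x : R) : 0 < s -> 0 < x ->
  ln (gamma_pdf s 1 x) = - ln (Gamma_fun s) + (s - 1) * ln x - x.
Proof.
move=> s0 x0; rewrite /gamma_pdf x0 powR1 mul1r divr1.
have G0 := Gamma_fun_gt0 s s0.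
rewrite !lnM ?posrE ?mulr_gt0 ?invr_gt0 ?powR_gt0 ?expR_gt0//.
by rewrite expRK ln_powR lnV ?posrE.
Qed.

(** The logarithm of [c * g (c * y) / f y] is [(t - s) * ln y + (1 - c) * y] up
    to an additive constant, which is strictly concave in [y].  So the
    difference of the two densities satisfies the sign condition of
    [negative_after_zero]. *)
Lemma dilated_cdf_lt {R : realType} (F G f g : R -> R) (l m n s t c x0 x1 : R) :
  continuous F -> continuous G -> F 0 = 0 -> G 0 = 0 ->
  (forall y : R, 0 < y -> is_derive y 1 F (f y)) ->
  (forall y : R, 0 < y -> is_derive y 1 G (g y)) ->
  F y @[y --> +oo] --> l -> G y @[y --> +oo] --> l ->
  (forall y, 0 < y -> 0 < f y) -> (forall y, 0 < y -> 0 < g y) ->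
  (forall y, 0 < y -> ln (f y) = m + (s - 1) * ln y - y) ->
  (forall y, 0 < y -> ln (g y) = n + (t - 1) * ln y - y) ->
  s < t -> 0 < c -> 0 < x0 -> F x0 = G (c * x0) -> x0 < x1 ->
  F x1 < G (c * x1).
Proof.
move=> cF cG F0 G0 dF dG Fy Gy fpos gpos lnf lng st c0 x00 E x01.
pose H y := F y - G (c * y).
pose h y := f y - c * g (c * y).
have cH : continuous H.
  move=> y; apply: cvgB; first exact: cF.
  by apply: continuous_comp; [exact: cvgMr|exact: cG].
have dH (y : R) : 0 < y -> is_derive y 1 H (h y).
  move=> y0; apply: is_deriveB; first exact: dF.
  by apply: is_derive_dilation; apply: dG; exact: mulr_gt0.
have H0 : H 0 = 0 by rewrite /H mulr0 F0 G0 subrr.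
have Hy : H x @[x --> +oo] --> 0.
  rewrite -[X in _ --> X](subrr l); apply: cvgB; first exact: Fy.
  apply: (cvg_comp _ G _ Gy).
  by apply: gt0_cvgMry => //; exact: cvg_id.
pose k := m - n - t * ln c.
have lnE (y : R) : 0 < y ->
    ln (c * g (c * y)) - ln (f y) = (t - s) * ln y + (1 - c) * y - k.
  move=> y0; have cy0 := mulr_gt0 c0 y0.
  rewrite lnM ?posrE ?gpos// lng// lnf// lnM ?posrE// /k; ring.
have cg_gt0 (y : R) : 0 < y -> 0 < c * g (c * y).
  by move=> y0; rewrite mulr_gt0 ?gpos ?mulr_gt0.
have hle (y : R) : 0 < y -> (h y <= 0) = (k <= (t - s) * ln y + (1 - c) * y).
  move=> y0; rewrite /h subr_le0 -ler_ln ?posrE ?fpos ?cg_gt0//.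
  by rewrite -subr_ge0 lnE// subr_ge0.
have hlt (y : R) : 0 < y -> (h y < 0) = (k < (t - s) * ln y + (1 - c) * y).
  move=> y0; rewrite /h subr_lt0 -ltr_ln ?posrE ?fpos ?cg_gt0//.
  by rewrite -subr_gt0 lnE// subr_gt0.
rewrite -subr_lt0; apply: (negative_after_zero H h x0 x1) => //.
- move=> y0 y1 y2 y00 y01 y12; have y10 := lt_trans y00 y01.
  rewrite hle// hle ?(lt_trans y10)// hlt//.
  by apply: log_affine_superlevel => //; rewrite subr_gt0.
- by rewrite /H E subrr.
Qed.

Lemma gamma_cdf_dilation_lt {R : realType} (s t : R) : 0 < s -> s < t ->
  forall c x0 x1, 0 < c -> 0 < x0 ->
  gamma_cdf s 1 x0 = gamma_cdf t 1 (c * x0) -> x0 < x1 ->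
  gamma_cdf s 1 x1 < gamma_cdf t 1 (c * x1).
Proof.
move=> s0 st c x0 x1; have t0 := lt_trans s0 st.
apply: (dilated_cdf_lt _ _ (gamma_pdf s 1) (gamma_pdf t 1) 1
  (- ln (Gamma_fun s)) (- ln (Gamma_fun t)) s t) st.
- exact: gamma_cdf_continuous s0 ltr01.
- exact: gamma_cdf_continuous t0 ltr01.
- exact: (gamma_cdf_le0 _ _ _ (lexx 0)).
- exact: (gamma_cdf_le0 _ _ _ (lexx 0)).
- exact: is_derive_gamma_cdf s0 ltr01.
- exact: is_derive_gamma_cdf t0 ltr01.
- exact: gamma_cdf_cvgy s0.
- exact: gamma_cdf_cvgy t0.
- exact: gamma_pdf_gt0 s0 ltr01.
- exact: gamma_pdf_gt0 t0 ltr01.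
- by move=> y; exact: ln_gamma_pdf.
- by move=> y; exact: ln_gamma_pdf.
Qed.

(** Dilate by [c = y1 / x1], so that [F] and [G (c * _)] agree at [x1]; after
    that point the second one is ahead, and reaches the value [F x2] before
    [x2]. *)
Lemma ratio_lt_of_dilation_lt {R : realType} (F G : R -> R) (x1 x2 y1 y2 : R) :
  (forall c z0 z1, 0 < c -> 0 < z0 -> F z0 = G (c * z0) -> z0 < z1 ->
     F z1 < G (c * z1)) ->
  nondecreasing_fun G -> 0 < x1 -> x1 < x2 -> 0 < y1 ->
  F x1 = G y1 -> F x2 = G y2 -> y2 / y1 < x2 / x1.
Proof.
move=> FG ndG x10 x12 y10 E1 E2.
have L : F x2 < G (y1 / x1 * x2).
  by apply: FG x12; rewrite ?divr_gt0// divfK// gt_eqF.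
rewrite ltr_pdivrMr// ltNge; apply/negP => W.
have /ndG : y1 / x1 * x2 <= y2 by rewrite mulrAC -mulrA mulrC.
by rewrite -E2 leNgt L.
Qed.

(** Gamma laws of larger shape are less spread out in the star order. *)
Lemma gamma_quantile_ratio_lt {R : realType} (s t p1 p2 : R) :
  0 < s -> s < t -> 0 < p1 -> p1 < p2 -> p2 < 1 ->
  gamma_quantile t p2 / gamma_quantile t p1 <
    gamma_quantile s p2 / gamma_quantile s p1.
Proof.
move=> s0 st p10 p12 p21; have t0 := lt_trans s0 st.
have p11 := lt_trans p12 p21; have p20 := lt_trans p10 p12.
have [qs1 Fs1] := gamma_quantileP s p1 s0 p10 p11.
have [qs2 Fs2] := gamma_quantileP s p2 s0 p20 p21.
have [qt1 Ft1] := gamma_quantileP t p1 t0 p10 p11.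
have [qt2 Ft2] := gamma_quantileP t p2 t0 p20 p21.
exact: (ratio_lt_of_dilation_lt _ _ _ _ _ _ (gamma_cdf_dilation_lt s t s0 st)
  (gamma_cdf_nondecreasing t 1 t0 ltr01) qs1
  (gamma_quantile_lt s p1 p2 s0 p10 p12 p21) qt1
  (etrans Fs1 (esym Ft1)) (etrans Fs2 (esym Ft2))).
Qed.

(** * Comparison of the mean lengths *)

(** Factor [u^-1 - v^-1] as [u^-1 * (1 - u / v)]: both factors are larger for
    the pair [u1], [v1]. *)
Lemma inv_diff_lt {R : realType} (u1 v1 u2 v2 : R) :
  0 < u1 -> u1 < v1 -> u1 < u2 -> 0 < v2 -> v2 / u2 < v1 / u1 ->
  u2^-1 - v2^-1 < u1^-1 - v1^-1.
Proof.
move=> u10 uv u12 v20 H; have u20 := lt_trans u10 u12.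
have v10 := lt_trans u10 uv.
have E (u v : R) : 0 < u -> 0 < v -> u^-1 - v^-1 = u^-1 * (1 - (v / u)^-1).
  by move=> u0 v0; field; rewrite !gt_eqF.
rewrite !E//.
have W : 1 - (v2 / u2)^-1 < 1 - (v1 / u1)^-1.
  by rewrite ltrD2l ltrN2 ltf_pV2 ?posrE ?divr_gt0.
have W1 : 0 < 1 - (v1 / u1)^-1.
  by rewrite subr_gt0 invf_lt1 ?divr_gt0// ltr_pdivlMr// mul1r.
have U : u2^-1 < u1^-1 by rewrite ltf_pV2 ?posrE.
apply: (@lt_trans _ _ (u2^-1 * (1 - (v1 / u1)^-1))).
  by rewrite ltr_pM2l ?invr_gt0.
by rewrite ltr_pM2r.
Qed.

(** As [F x = p < F (s * x0)], the normalized point [x / s] lies before [x0],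
    where the normalized version of [G] is the smaller one and so takes the
    value [p] later. *)
Lemma normalized_quantile_lt {R : realType} (F G : R -> R) (s t p x0 x y : R) :
  nondecreasing_fun F -> nondecreasing_fun G -> 0 < s -> 0 < t -> 0 < x ->
  (forall z, 0 < z -> z < x0 -> G (t * z) < F (s * z)) ->
  p < F (s * x0) -> F x = p -> G y = p -> x / s < y / t.
Proof.
move=> ndF ndG s0 t0 x_gt0 cross px0 Fx Gy.
have xs : s * (x / s) = x by rewrite mulrC divfK// gt_eqF.
have xx0 : x / s < x0.
  rewrite ltNge; apply/negP => W.
  have /ndF : s * x0 <= s * (x / s) by rewrite ler_pM2l.
  by rewrite xs Fx leNgt px0.
have := cross _ (divr_gt0 x_gt0 s0) xx0; rewrite xs Fx -Gy => L.
rewrite ltNge; apply/negP; rewrite ler_pdivrMr// mulrC => /ndG.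
by rewrite leNgt L.
Qed.

Theorem theorem1 (R : realType) (a b alpha : R) (n : nat)
  (ha : 0 < a) (hb : 0 < b) (hn : (1 <= n)%N)
  (halpha0 : 0 < alpha) (halpha1 : alpha < 1)
  (hstar : alpha < alpha_star n a) :
  mean_ci_length n.+1 a b alpha < mean_ci_length n a b alpha.
Proof.
have s0 : 0 < n%:R * a by rewrite mulr_gt0// ltr0n.
have st : n%:R * a < n.+1%:R * a by rewrite ltr_pM2r// ltr_nat.
have t0 := lt_trans s0 st.
have meanE m (x : R) : 0 < m%:R * a -> 0 < x ->
    mean_cdf m a x = gamma_cdf (m%:R * a) 1 (m%:R * a * x).
  move=> m0 x0; rewrite /mean_cdf (gamma_cdf_scale _ (m%:R * a)^-1) ?invrK//.
  by rewrite invr_gt0.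
(* without a crossing point the default 0 is taken, and [alpha_star] would be
   the distribution function at 0, which vanishes *)
move: hstar; rewrite /alpha_star.
case: xgetP => [x0 _ [x00 cross _] hstar|_]; last first.
  rewrite /mean_cdf gamma_cdf_le0// => /(lt_trans halpha0).
  by rewrite ltxx.
rewrite meanE// in hstar.
have {}cross z : 0 < z -> z < x0 ->
    gamma_cdf (n.+1%:R * a) 1 (n.+1%:R * a * z) <
    gamma_cdf (n%:R * a) 1 (n%:R * a * z).
  by move=> z0 zx0; rewrite -!meanE//; exact: cross.
rewrite /mean_ci_length ltr_pM2l// !div1r.
move: (n%:R * a) (n.+1%:R * a) s0 st t0 hstar cross {meanE}.
move=> s t s0 st t0 hstar cross.
have p10 : 0 < alpha / 2 by rewrite divr_gt0.
have p12 : alpha / 2 < 1 - alpha / 2 by lra.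
have p21 : 1 - alpha / 2 < 1 by lra.
have p1star : alpha / 2 < gamma_cdf s 1 (s * x0).
  by apply: lt_trans hstar; lra.
have p11 := lt_trans p12 p21; have p20 := lt_trans p10 p12.
have [qs1 Fs1] := gamma_quantileP s _ s0 p10 p11.
have [qt1 Ft1] := gamma_quantileP t _ t0 p10 p11.
have [qt2 _] := gamma_quantileP t _ t0 p20 p21.
have q12 := gamma_quantile_lt s _ _ s0 p10 p12 p21.
have ratio := gamma_quantile_ratio_lt s t _ _ s0 st p10 p12 p21.
have u12 := normalized_quantile_lt _ _ s t _ _ _ _
  (gamma_cdf_nondecreasing s 1 s0 ltr01) (gamma_cdf_nondecreasing t 1 t0 ltr01)
  s0 t0 qs1 cross p1star Fs1 Ft1.
move: (gamma_quantile s (alpha / 2)) (gamma_quantile s (1 - alpha / 2))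
  (gamma_quantile t (alpha / 2)) (gamma_quantile t (1 - alpha / 2))
  ratio u12 q12 qs1 qt1 qt2 {Fs1 Ft1 cross hstar p1star}.
move=> u1 u2 v1 v2 ratio u12 q12 u1_gt0 v1_gt0 v2_gt0.
apply: inv_diff_lt; rewrite ?divr_gt0 ?ltr_pM2r ?invr_gt0//.
have cancel x y w : 0 < w -> x / w / (y / w) = x / y :> R.
  by move=> w0; rewrite invf_div mulrA divfK// gt_eqF.
by rewrite !cancel.
Qed.
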